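(* Let $n\geq 1$ and $q,\alpha,\beta\in\mathbb N$ with $\gcd(\alpha,\beta)=1$, and let $C(n,q\alpha)\in\{a<z\}^n$ and $C(n,q\beta)\in\{b<z\}^n$ be two superimposable Christoffel words. Let $r$ be an integer with $qr\equiv1\pmod n$. Then $C(n,q\alpha)$ and $\gamma^{1-r}\,\widetilde C(n,q\beta)$ are perfectly superimposable.
   Context: $\mathbb N=\{0,1,2,\dots\}$. For coprime $s,t\in\mathbb N$ and $n=s+t$, the Christoffel word over the ordered alphabet $\{a<z\}$ with $s$ occurrences of $a$ and $t$ occurrences of $z$ is $u=u[0]u[1]\cdots u[n-1]$ with $u[i]=a$ if $((i+1)t \bmod n)>(it\bmod n)$ and $u[i]=z$ otherwise. It is denoted $C(n,s)$; calling $C(n,s)$ a Christoffel word presupposes $\gcd(n,s)=1$. Over $\{b<z\}$ the definition is the same with $b$ in place of $a$. $\widetilde C(n,s)$ denotes the reversal (mirror image) of $C(n,s)$. For a letter $c$ and a finite word $w$, $\gamma(cw)=wc$; $\gamma$ is a bijection on words of a given length, and $\gamma^k$ is defined for all $k\in\mathbb Z$. Let $u\in\{a,z\}^n$ and $v\in\{b,z\}^m$, let $A$ be the set of positions (indexed from $0$) of the letter $a$ in $u$ and $B$ the set of positions of the letter $b$ in $v$. The words $u,v$ are perfectly superimposable if $(A+n\mathbb Z)\cap(B+m\mathbb Z)=\emptyset$, and superimposable if there is $k\in\mathbb Z$ with $(A+n\mathbb Z)\cap(B-k+m\mathbb Z)=\emptyset$ (equivalently, $u$ and $\gamma^k(v)$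 are perfectly superimposable for some $k$). *)

(* Defs.v *)
From mathcomp Require Import all_boot all_order all_algebra.

Set Implicit Arguments.
Unset Strict Implicit.
Unset Printing Implicit Defensive.

(* Words are sequences over an arbitrary eqType.  The order a < z on the      *)
(* alphabet only says which letter marks the ascents of i |-> i t mod n, so   *)
(* it is rendered by the order of the letter arguments.                       *)

(* C(n, s) over {a < z}, with t = n - s; meaningful when s <= n and           *)
(* coprime n s.  In the degenerate case n = s = 1 the defining formula yields *)
(* the word z, not a.                                                         *)
Definition christoffel (T : eqType) (a z : T) (n s : nat) : seq T :=
  mkseq (fun i => if i * (n - s) %% n < i.+1 * (n - s) %% n then a else z) n.

(* gamma^k, where gamma (c w) = w c is rot 1 and its inverse is rotr 1.       *)
Definition gammaz (T : Type) (k : int) (w : seq T) : seq T :=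
  match k with
  | Posz j => iter j (rot 1) w
  | Negz j => iter j.+1 (rotr 1) w
  end.

Definition positions (T : eqType) (c : T) (w : seq T) : pred nat :=
  [pred i | (i < size w) && (nth c w i == c)].

(* x \in A - k + n Z *)
Definition in_translates (A : pred nat) (k : int) (n : nat) (x : int) : Prop :=
  exists (i : nat) (j : int), i \in A /\ x = (i%:Z - k + j * n%:Z)%R.

Definition perfectly_superimposable (T : eqType) (a b : T) (u v : seq T) :
    Prop :=
  forall x : int,
    ~ (in_translates (positions a u) 0%R (size u) x /\
       in_translates (positions b v) 0%R (size v) x).

Definition superimposable (T : eqType) (a b : T) (u v : seq T) : Prop :=
  exists k : int, forall x : int,
    ~ (in_translates (positions a u) 0%R (size u) x /\
       in_translates (positions b v) k (size v) x).

(* Main.v *)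
(* The letter [a] of [C(n, q alpha)] sits at [i] iff [- i q alpha mod n] lies
   in [[0, q alpha)]. In the coordinate [w = - q i mod n], these positions form
   [alpha] intervals of length [q], starting at the multiples [i / alpha],
   [0 <= i < alpha]. After multiplication by [alpha beta], superimposability
   says that the residues [i beta + i' alpha] ([i < alpha], [i' < beta]) miss
   some [2 q - 1] consecutive terms of an arithmetic progression of step
   [alpha beta] modulo [n]; the conclusion says that they miss the terms
   [alpha beta, ..., (2 q - 1) alpha beta]. Both are equivalent to the existence
   of [x, y > 0] with [n = x beta + y alpha + 2 alpha beta (q - 1)]. *)

Require Import Defs.
From mathcomp Require Import all_boot all_order all_algebra.
From mathcomp Require Import zify ring.
Import Order.TTheory GRing.Theory Num.Theory.

(** * Simpson's criterion as integer arithmetic *)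

Section Arithmetic.

Local Open Scope ring_scope.

Lemma divz_eq_pos (m d : int) : 0 < d ->
  exists f e : int, [/\ m = e * d + f, 0 <= f & f < d].
Proof.
move=> d0; exists (m %% d)%Z, (m %/ d)%Z; split; first exact: divz_eq.
  by rewrite modz_ge0 // gt_eqF.
exact: ltz_pmod.
Qed.

Lemma modz_eq_of_lt {m d e f : int} :
  m = e * d + f -> 0 <= f -> f < d -> (m %% d)%Z = f.
Proof. by move=> -> f0 fd; rewrite modzMDl modz_small // f0. Qed.

Lemma quotient_lt (d e f q : int) :
  0 <= e * d + f -> e * d + f < q * d -> 0 <= f -> f < d -> 0 <= e < q.
Proof. by move=> u0 uq f0 fd; apply/andP; split; nia. Qed.

Lemma nat_crossing {g : nat -> int} {b : int} {N : nat} :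
  g 0%N < b -> b <= g N -> exists k : nat, g k < b /\ b <= g k.+1.
Proof.
move=> g0; elim: N => [|N IHN] gN; first by rewrite leNgt g0 in gN.
by case: (ltP (g N) b) => [lt|/IHN //]; exists N.
Qed.

(* Simpson's criterion for rational Beatty sequences, easy direction. By
   coprimality [i = k x + m al] and [i' = k y + m' be] with
   [m + m' = J + 2 k (q - 1)]; the bounds on [i] and [i'] contradict this for
   either sign of [k]. *)
Lemma avoid_of_decomposition (al be q n x y J k i i' : int) :
  0 < al -> 0 < be -> coprimez al be ->
  0 < x -> 0 < y -> n = x * be + y * al + 2 * al * be * (q - 1) ->
  1 <= J -> J <= 2 * q - 1 -> 0 <= i -> i < al -> 0 <= i' -> i' < be ->
  J * al * be + k * n <> i * be + i' * al.
Proof.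
move=> al0 be0 cab x0 y0 En J1 J2 i0 ial i'0 i'be E.
have dv : (al %| (i - k * x) * be)%Z.
  apply/dvdzP; exists (J * be + k * y + 2 * k * (q - 1) * be - i').
  by rewrite En in E; lia.
rewrite Gauss_dvdzl // in dv.
case/dvdzP: dv => m Em.
have Em' : i' - k * y = (J + 2 * k * (q - 1) - m) * be.
  apply: (mulfI (lt0r_neq0 al0)).
  have := congr1 (fun z => be * z) Em.
  by rewrite En in E; lia.
(* For [k >= 0] both multipliers of [al] and [be] are at most 0, yet their sum [J + 2 k (q - 1)] is
   at least 1. For [k < 0] both are at least 1, yet their sum is at most
   [2 q - 1 - 2 (q - 1) = 1]. *)
case: (lerP 0 k) => k0.
- have kx : 0 <= k * x by nia.
  have ky : 0 <= k * y by nia.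
  have m0 : m <= 0 by nia.
  have : J + 2 * k * (q - 1) - m <= 0 by nia.
  by nia.
- have kx : k * x < 0 by nia.
  have ky : k * y < 0 by nia.
  have m0 : 1 <= m by nia.
  have : 1 <= J + 2 * k * (q - 1) - m by nia.
  by nia.
Qed.

(* Simpson's criterion, hard direction. Write [n = x be + y al]. The integers
   [ceil ((k x + c al) / al) + floor (k y / be)], for [k] in [Z], all avoid
   [(- q, q)], hence some step jumps by at least [2 q]; as a step is at most
   [ceil (x / al) + ceil (y / be)], enough copies of [al] and [be] can be
   removed from [x] and [y]. *)
Lemma decomposition_of_avoid (al be q n c : int) :
  0 < al -> 0 < be -> 0 < n -> coprimez al be ->
  (forall d i i' e : int, - q < d -> d < q ->
     0 <= i -> i < al -> 0 <= i' -> i' < be ->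
     c * al * be + e * n <> d * al * be - i * be + i' * al) ->
  exists x y : int,
    [/\ 0 < x, 0 < y & n = x * be + y * al + 2 * al * be * (q - 1)].
Proof.
move=> al0 be0 n0 cab avoid.
have [x [y En]] : exists x y : int, n = x * be + y * al.
  have [u [v uv]] := Bezoutz be al.
  exists (n * u), (n * v).
  have g1 : gcdz be al = 1 by apply/eqP; rewrite gcdzC.
  have := congr1 (fun z => n * z) uv; rewrite g1; lia.
pose s (k : int) : int := - ((- (k * x + c * al)) %/ al)%Z.
pose t (k : int) : int := ((k * y) %/ be)%Z.
have sP k : exists i, [/\ k * x + c * al = al * s k - i, 0 <= i & i < al].
  exists ((- (k * x + c * al)) %% al)%Z; split.
  - have := divz_eq (- (k * x + c * al)) al; rewrite /s; lia.
  - by rewrite modz_ge0 // gt_eqF.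
  - exact: ltz_pmod.
have tP k : exists i, [/\ k * y = be * t k + i, 0 <= i & i < be].
  exists ((k * y) %% be)%Z; split.
  - have := divz_eq (k * y) be; rewrite /t; lia.
  - by rewrite modz_ge0 // gt_eqF.
  - exact: ltz_pmod.
have stP k : exists i i', [/\ 0 <= i < al, 0 <= i' < be &
    c * al * be + k * n = (s k + t k) * al * be - i * be + i' * al].
  have [i [Ei i0 i1]] := sP k; have [i' [Ei' i'0 i'1]] := tP k.
  exists i, i'; split; rewrite ?i0 ?i'0 //.
  have := congr1 (fun z => be * z) Ei; have := congr1 (fun z => al * z) Ei'.
  rewrite En; lia.
have gap k : s k + t k < q -> s k + t k <= - q.
  move=> lt; rewrite leNgt; apply/negP => gt.
  have [i [i' [/andP[i0 i1] /andP[i'0 i'1] E]]] := stP k.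
  exact: (avoid (s k + t k) i i' k) E.
(* Large enough for [M n] to outweigh [c al be], [q al be] and the remainders, so that [s + t] is
   below [q] at [- M] and at least [q] at [M]. *)
pose M : int := al * be * (`|c| + `|q| + 1).
have M0 : 0 <= M by rewrite /M; apply: mulr_ge0; [apply: mulr_ge0|]; lia.
have ab0 : 0 < al * be by exact: mulr_gt0.
have Mn : M <= M * n by nia.
have low : s (- M) + t (- M) < q.
  have [i [i' [/andP[i0 i1] /andP[i'0 i'1] E]]] := stP (- M).
  have ib : 0 <= i * be by nia.
  have ia : i' * al < al * be by nia.
  have ib' : i * be < al * be by nia.
  rewrite -(ltr_pM2l ab0).
  have : al * be * (c + 1 - `|c| - `|q| - 1) <= al * be * q.
    by rewrite ler_pM2l //; lia.
  by rewrite /M in Mn E *; lia.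
have high : q <= s M + t M.
  have [i [i' [/andP[i0 i1] /andP[i'0 i'1] E]]] := stP M.
  have ib : 0 <= i' * al by nia.
  have ia : 0 <= i * be by nia.
  have ib' : i' * al < al * be by nia.
  rewrite -(ler_pM2l ab0).
  have : al * be * q <= al * be * (c - 1 + `|c| + `|q| + 1).
    by rewrite ler_pM2l //; lia.
  by rewrite /M in Mn E *; lia.
pose g (j : nat) : int := s (- M + j%:Z) + t (- M + j%:Z).
have [j [jlt jge]] : exists j : nat, g j < q /\ q <= g j.+1.
  apply: (@nat_crossing g q `|(M + M)%R|%N); rewrite /g ?addr0 //.
  by have -> : - M + `|(M + M)%R|%N%:Z = M by lia.
pose k : int := - M + j%:Z.
have Ek : - M + j.+1%:Z = k + 1 by rewrite /k; lia.
rewrite /g Ek -/k in jlt jge; have {jlt} jle := gap k jlt.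
pose X : int := - ((- x) %/ al)%Z; pose Y : int := - ((- y) %/ be)%Z.
have [XP1 XP2] : x <= al * X /\ al * (X - 1) < x.
  have := divz_eq (- x) al; have := ltz_pmod (- x) al0.
  have : 0 <= ((- x) %% al)%Z by rewrite modz_ge0 // gt_eqF.
  by rewrite /X; lia.
have [YP1 YP2] : y <= be * Y /\ be * (Y - 1) < y.
  have := divz_eq (- y) be; have := ltz_pmod (- y) be0.
  have : 0 <= ((- y) %% be)%Z by rewrite modz_ge0 // gt_eqF.
  by rewrite /Y; lia.
have sX : s (k + 1) - s k <= X.
  have [i [Ei i0 i1]] := sP k; have [i' [Ei' i'0 i'1]] := sP (k + 1).
  by rewrite -ltzD1 -(ltr_pM2l al0); lia.
have tY : t (k + 1) - t k <= Y.
  have [i [Ei i0 i1]] := tP k; have [i' [Ei' i'0 i'1]] := tP (k + 1).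
  by rewrite -ltzD1 -(ltr_pM2l be0); lia.
have XY : 2 * (q - 1) - (X - 1) <= Y - 1 by lia.
(* With [X] and [Y] the ceilings of [x / al] and [y / be], removing [X - 1] copies of [al], or at
   most [Y - 1] copies of [be], leaves a positive number. The jump gives [X + Y >= 2 q], so
   [2 (q - 1)] copies can be removed in all. *)
exists (x - al * (X - 1)), (y - be * (2 * (q - 1) - (X - 1))); split.
- by lia.
- have := ler_pM2l be0 (2 * (q - 1) - (X - 1)) (Y - 1); rewrite XY; lia.
- by rewrite {1}En; ring.
Qed.

End Arithmetic.

(** * Periodic extensions of words *)

Section PeriodicWords.

Context {T : eqType}.
Implicit Types (w : seq T) (c a : T).

(** Extends [w] periodically to all integers, so that rotation and reversal become affine changes of
    the index; on the empty word the value is [x0]. *)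
Definition letter (x0 : T) w (i : int) : T := nth x0 w `|(i %% (size w)%:Z)%Z|.

Lemma in_translates_letter x0 {c w} {n : nat} {k x : int} :
  0 < n -> size w = n ->
  in_translates (positions c w) k n x <-> letter x0 w (x + k)%R = c.
Proof.
move=> n0 sw; rewrite -sw in n0 *; rewrite /letter; split.
- move=> [i [j [/andP[ltw /eqP nthc] ->]]].
  rewrite (@modz_eq_of_lt _ _ j i) ?absz_nat; try lia.
  by rewrite (set_nth_default c).
- have [|f [e [E f0 f1]]] := divz_eq_pos (x + k)%R (size w); first by lia.
  rewrite (modz_eq_of_lt E f0 f1) => nthc.
  exists `|f|%N, e; split; last by lia.
  rewrite inE /=; apply/andP; split; first by lia.
  by rewrite (set_nth_default x0) ?nthc //; lia.
Qed.

Lemma letter_rot1 x0 w i : letter x0 (rot 1 w) i = letter x0 w (i + 1)%R.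
Proof.
rewrite /letter size_rot; case: w => [|c w]; first by rewrite !nth_nil.
rewrite rot1_cons /=.
have [|f [e [E f0 f1]]] := divz_eq_pos i (size w).+1; first by lia.
rewrite (modz_eq_of_lt E f0 f1) nth_rcons.
case: ltngtP => ltf; last 1 first.
- rewrite (@modz_eq_of_lt _ _ (e + 1)%R 0%R) //; lia.
- rewrite (@modz_eq_of_lt _ _ e (f + 1)%R); try lia.
  by have -> : `|(f + 1)%R|%N = `|f|%N.+1 by lia.
- by lia.
Qed.

Lemma letter_gammaz x0 w k i : letter x0 (gammaz k w) i = letter x0 w (i + k)%R.
Proof.
have rotr1 u j : letter x0 (rotr 1 u) j = letter x0 u (j - 1)%R.
  by rewrite -{2}(rotrK 1 u) letter_rot1; congr letter; lia.
case: k => j; rewrite /gammaz.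
- elim: j i => [|j IHj] i; first by congr letter; lia.
  by rewrite iterS letter_rot1 IHj; congr letter; lia.
- elim: j i => [|j IHj] i; first by rewrite /= rotr1; congr letter; lia.
  by rewrite iterS rotr1 IHj; congr letter; lia.
Qed.

Lemma size_gammaz k w : size (gammaz k w) = size w.
Proof.
by case: k => j; elim: j => [|j IHj] //=; rewrite ?size_rot ?size_rotr // -IHj size_rotr.
Qed.

Lemma letter_rev x0 w i : letter x0 (rev w) i = letter x0 w (- 1 - i)%R.
Proof.
rewrite /letter size_rev; case: (posnP (size w)) => [/size0nil ->|w0].
  by rewrite !nth_nil.
have [|f [e [E f0 f1]]] := divz_eq_pos i (size w); first by lia.
rewrite (modz_eq_of_lt E f0 f1) nth_rev; last by lia.
rewrite (@modz_eq_of_lt _ _ (- e - 1)%R ((size w)%:Z - 1 - f)%R); try lia.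
congr nth; lia.
Qed.

(** The residue [m] of [i (n - s)] is also that of [- i s]. Adding [n - s] to it stays below [n],
    giving an ascent, exactly when [m < s]; otherwise it wraps around to [m - s]. *)
Lemma letter_christoffel {a x0 n s i} : a != x0 -> 0 < s -> s < n ->
  letter x0 (christoffel a x0 n s) i = a <->
  exists u e : int, [/\ - (i * s%:Z) = e * n%:Z + u, 0 <= u & u < s%:Z]%R.
Proof.
move=> neq s0 sn; rewrite /letter size_mkseq.
have [|f [e [E f0 f1]]] := divz_eq_pos i n; first by lia.
rewrite (modz_eq_of_lt E f0 f1) nth_mkseq; last by lia.
set j := `|f|%N; have Ef : f = j by lia.
set m := j * (n - s) %% n; set p := j * (n - s) %/ n.
have Em : j * (n - s) = p * n + m by exact: divn_eq.
have mn : m < n by rewrite ltn_mod; lia.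
have -> : (m < j.+1 * (n - s) %% n) = (m < s).
  rewrite mulSn Em addnCA modnMDl; case: (ltnP m s) => ms.
    by rewrite modn_small; lia.
  have -> : n - s + m = m - s + n by lia.
  by rewrite modnDr modn_small; lia.
have Emz : (- (i * s%:Z) = (p%:Z - j%:Z - e * s%:Z) * n%:Z + m%:Z)%R.
  have Ens : (j%:Z * (n%:Z - s%:Z) = p%:Z * n%:Z + m%:Z)%R.
    by rewrite subzn ?(ltnW sn) // -PoszM Em PoszD PoszM.
  by rewrite E Ef; lia.
split.
- case: ltnP => [ms _|_ /eqP]; last by rewrite eq_sym (negPf neq).
  by exists (m : int), (p%:Z - j%:Z - e * s%:Z)%R; split; rewrite ?Emz //; lia.
- move=> [u [d [Eu u0 us]]].
  suff -> : m < s by [].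
  have um := modz_eq_of_lt Eu u0 (lt_trans us (ltac:(lia) : (s%:Z < n%:Z)%R)).
  by rewrite (@modz_eq_of_lt _ _ _ m Emz) in um; lia.
Qed.

End PeriodicWords.

(** * Translation of superimposability into the criterion *)

Theorem theorem3p33 (T : eqType) (a b z : T) (haz : a != z) (hbz : b != z)
    (n q alpha beta : nat) (r : int)
    (hn : 1 <= n)
    (hab : coprime alpha beta)
    (hqa_le : q * alpha <= n) (hqa : coprime n (q * alpha))
    (hqb_le : q * beta <= n) (hqb : coprime n (q * beta))
    (hsup : superimposable a b (christoffel a z n (q * alpha))
                               (christoffel b z n (q * beta)))
    (hr : (q%:Z * r = 1 %[mod n%:Z])%Z) :
  perfectly_superimposable a b
    (christoffel a z n (q * alpha))
    (gammaz (1 - r)%R (rev (christoffel b z n (q * beta)))).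
Proof.
have size_c c s : size (christoffel c z n s) = n by rewrite size_mkseq.
move=> x []; rewrite size_gammaz size_rev !size_c.
move=> /(in_translates_letter z hn (size_c _ _)); rewrite addr0 => La.
have size_v : size (gammaz (1 - r)%R (rev (christoffel b z n (q * beta)))) = n.
  by rewrite size_gammaz size_rev size_c.
move=> /(in_translates_letter z hn size_v).
rewrite letter_gammaz letter_rev addr0 => Lb.
have [n_gt1|n_le1] := ltnP 1 n; last first.
  have n1 : n = 1%N by lia.
  move: La; rewrite /letter size_c n1 modz1 nth_mkseq // !modn1 ltnn => za.
  by rewrite za eqxx in haz.
have range s : s <= n -> coprime n s -> 0 < s /\ s < n.
  rewrite leq_eqVlt => /orP[/eqP ->|ltsn cns].
    by rewrite /coprime gcdnn => /eqP; lia.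
  split=> //; rewrite lt0n; apply/eqP => s0.
  by move: cns; rewrite s0 /coprime gcdn0 => /eqP; lia.
have [qa0 qan] := range _ hqa_le hqa; have [qb0 qbn] := range _ hqb_le hqb.
have [q0 al0] : 0 < q /\ 0 < alpha by apply/andP; rewrite -muln_gt0.
have be0 : 0 < beta by move: qb0; rewrite muln_gt0 => /andP[].
have [r' Er] : exists r' : int, (q%:Z * r = 1 + r' * n%:Z)%R.
  move/eqP: hr; rewrite eqz_mod_dvd => /dvdzP[e E]; exists e; lia.
have [A [A' EA]] : exists A A' : int, (alpha%:Z * A = 1 + A' * n%:Z)%R.
  have can : gcdz alpha n = 1%R.
    have : coprime n alpha by move: hqa; rewrite coprimeMr => /andP[].
    by rewrite coprime_sym /gcdz /coprime /= => /eqP ->.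
  have [u [w E]] := Bezoutz alpha n; exists u, (- w)%R.
  by rewrite can in E; lia.
have cab : coprimez alpha beta by [].
case: hsup => k hk; rewrite !size_c in hk.
(* A shift of positions by [k] is a shift by [- k q] in the coordinate [w]. *)
have [|||//|d i i' e d1 d2 i0 i1 i'0 i'1 E|x1 [y1 [x0 y0 En]]] :=
  @decomposition_of_avoid alpha beta q n (- (k * q%:Z))%R.
- by lia.
- by lia.
- by lia.
- have [j [j' [Ed j0 j1 j'0 j'1]]] : exists j j' : int,
      [/\ (d = j' - j)%R, (0 <= j)%R, (j < q%:Z)%R, (0 <= j')%R
        & (j' < q%:Z)%R].
    case: (lerP 0%R d) => d0; [exists 0%R, d|exists (- d)%R, 0%R]; split; lia.
  (* As [A] inverts [alpha] modulo [n], [w alpha] is congruent to [j alpha + i], which lies in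
     [[0, q alpha)]. By [E], [(w - k q) beta] is congruent to [j' beta + i'], which lies in
     [[0, q beta)]. Hence both letters occur at the position [- w r]. *)
  pose w := (j + i * A)%R.
  apply: (hk (- (w * r))%R); split.
    apply/(in_translates_letter z hn (size_c _ _)).
    apply/letter_christoffel => //.
    exists (j * alpha%:Z + i)%R, (w * alpha%:Z * r' + i * A')%R; split.
    + rewrite addr0 PoszM mulNr opprK.
      have -> : (w * r * (q%:Z * alpha%:Z) =
        (w * alpha%:Z) * (q%:Z * r))%R by ring.
      rewrite Er; have := congr1 (fun t => (i * t)%R) EA; rewrite /w; lia.
    + by nia.
    + by nia.
  apply/(in_translates_letter z hn (size_c _ _)).
  apply/letter_christoffel => //.
  exists (j' * beta%:Z + i')%R.
  exists (w * beta%:Z * r' + (i' + j' * beta%:Z) * A' + A * (i * beta%:Z * A' - e)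
          - A' * beta%:Z * (w - k * q%:Z))%R.
  split; last 2 first; [by nia|by nia|].
  rewrite PoszM.
  have E1 := congr1 (fun t => (w * beta%:Z * t)%R) Er.
  have E2 := congr1 (fun t => (beta%:Z * (w - k * q%:Z) * t)%R) EA.
  have E3 := congr1 (fun t => (A * t)%R) E.
  have E4 := congr1 (fun t => ((j' * beta%:Z + i') * t)%R) EA.
  have E5 := congr1 (fun t => (A * i * beta%:Z * t)%R) EA.
  by rewrite Ed in E3; rewrite /w in E1 E2 *; lia.
move/letter_christoffel: La => /(_ haz qa0 qan)[u [e1 [Eu u0 u1]]].
move/letter_christoffel: Lb => /(_ hbz qb0 qbn)[u' [e2 [Eu' u'0 u'1]]].
have [|i [j [Ej i0 i1]]] := divz_eq_pos u alpha; first by lia.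
have [|i' [j' [Ej' i'0 i'1]]] := divz_eq_pos u' beta; first by lia.
have jq : (0 <= j < q%:Z)%R by apply: (@quotient_lt alpha j i); lia.
have j'q : (0 <= j' < q%:Z)%R by apply: (@quotient_lt beta j' i'); lia.
(* The second letter is read at [r - 2 - x], so [q r = 1] modulo [n] makes [u beta + u' alpha]
   congruent to [(2 q - 1) alpha beta]. Subtracting [(j + j') alpha beta] leaves [i beta + i' alpha]
   and a multiplier between [1] and [2 q - 1]. *)
apply: (@avoid_of_decomposition alpha beta q n x1 y1
  (2 * q%:Z - 1 - j - j')%R
  (- (alpha%:Z * (e2 + r' * beta%:Z) + beta%:Z * e1))%R i i') => //; try lia.
have E1 := congr1 (fun t => (beta%:Z * t)%R) Eu.
have E2 := congr1 (fun t => (alpha%:Z * t)%R) Eu'.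
have E3 := congr1 (fun t => (alpha%:Z * beta%:Z * t)%R) Er.
by rewrite Ej in E1; rewrite Ej' in E2; lia.
Qed.
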